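(* Let $a\in(0,1)$ and let $\rho,\sigma_1,\sigma_2$ be states with $T(\sigma_1,\sigma_2)=t$. Then $$|S_a(\rho\|\sigma_1)-S_a(\rho\|\sigma_2)|\le 1-S_a(1\|t)=\frac{\log(a+(1-a)t)-\log a}{-\log a}\le \frac{1-a}{-a\log a}\,t.$$ Moreover, equality in the first inequality holds when $\rho\perp\sigma_1$ (i.e. $\mathrm{Tr}\,\rho\sigma_1=0$) and $\sigma_2=t\rho+(1-t)\sigma_1$.
   Context: All operators act on a finite-dimensional complex Hilbert space; a state is a positive semidefinite operator of trace one. $T(\rho,\sigma)=\frac12\|\rho-\sigma\|_1=\mathrm{Tr}(\rho-\sigma)_+$ is the trace distance, where $X_+=(X+|X|)/2$. For positive semidefinite $A,B$, the relative entropy is $S(A\|B)=\mathrm{Tr}\,A(\log A-\log B)$ (logarithms taken on supports, $0\log 0=0$, and $S(A\|B)=+\infty$ if the support of $A$ is not contained in that of $B$). For $a\in(0,1)$ the telescopic relative entropy is $S_a(A\|B)=\frac{1}{-\log a}S(A\|aA+(1-a)B)$. For nonnegative scalars $b,c$ this reads $S_a(b\|c)=\frac{b(\log b-\log(ab+(1-a)c))}{-\log a}$ (with $0\log 0=0$). *)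

(* Defs.v *)
(* complex numbers built as pairs of Stdlib reals,
   n x n complex matrices as functions nat -> nat -> C (only indices < n matter). *)
From Stdlib Require Import Reals Lra List ClassicalEpsilon.
Open Scope R_scope.

Record C := mkC { re : R; im : R }.
Definition C0 : C := mkC 0 0.
Definition Cofr (r : R) : C := mkC r 0.
Definition Cadd (x y : C) : C := mkC (re x + re y) (im x + im y).
Definition Cmul (x y : C) : C :=
  mkC (re x * re y - im x * im y) (re x * im y + im x * re y).
Definition Cconj (x : C) : C := mkC (re x) (- im x).

Definition csum (n : nat) (f : nat -> C) : C :=
  fold_right Cadd C0 (map f (seq 0 n)).

Definition Mat := nat -> nat -> C.
Definition Vec := nat -> C.

Definition meq (n : nat) (A B : Mat) : Prop :=
  forall i j, (i < n)%nat -> (j < n)%nat -> A i j = B i j.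
Definition madd (A B : Mat) : Mat := fun i j => Cadd (A i j) (B i j).
Definition mscale (r : R) (A : Mat) : Mat := fun i j => Cmul (Cofr r) (A i j).
Definition mmul (n : nat) (A B : Mat) : Mat :=
  fun i j => csum n (fun k => Cmul (A i k) (B k j)).
Definition adj (A : Mat) : Mat := fun i j => Cconj (A j i).
Definition idm : Mat := fun i j => if Nat.eqb i j then Cofr 1 else C0.
Definition diagm (d : nat -> R) : Mat :=
  fun i j => if Nat.eqb i j then Cofr (d i) else C0.
Definition trace (n : nat) (A : Mat) : C := csum n (fun i => A i i).
Definition mvec (n : nat) (A : Mat) (x : Vec) : Vec :=
  fun i => csum n (fun j => Cmul (A i j) (x j)).

Definition hermitian (n : nat) (A : Mat) : Prop := meq n (adj A) A.
Definition psd (n : nat) (A : Mat) : Prop :=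
  hermitian n A /\
  forall x : Vec, 0 <= re (csum n (fun i => Cmul (Cconj (x i)) (mvec n A x i))).
Definition state (n : nat) (A : Mat) : Prop := psd n A /\ trace n A = Cofr 1.

Definition unitary (n : nat) (U : Mat) : Prop := meq n (mmul n (adj U) U) idm.

Definition spec_decomp (n : nat) (A : Mat) (p : (nat -> R) * Mat) : Prop :=
  unitary n (snd p) /\
  meq n A (mmul n (mmul n (snd p) (diagm (fst p))) (adj (snd p))).

Definition funcalc (n : nat) (f : R -> R) (A : Mat) : Mat :=
  let p := epsilon (inhabits ((fun _ => 0), (fun _ _ => C0))) (spec_decomp n A) in
  mmul n (mmul n (snd p) (diagm (fun i => f (fst p i)))) (adj (snd p)).

(* logarithm taken on the support *)
Definition logs (x : R) : R := if Rlt_dec 0 x then ln x else 0.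

(* support of A contained in support of B  <->  ker B contained in ker A *)
Definition supp_sub (n : nat) (A B : Mat) : Prop :=
  forall x : Vec, (forall i, (i < n)%nat -> mvec n B x i = C0) ->
                  (forall i, (i < n)%nat -> mvec n A x i = C0).

(* relative entropy; None stands for +infinity *)
Definition relent (n : nat) (A B : Mat) : option R :=
  if excluded_middle_informative (supp_sub n A B)
  then Some (re (trace n (mmul n A (funcalc n logs A)))
             - re (trace n (mmul n A (funcalc n logs B))))
  else None.

(* telescopic relative entropy (always finite for a in (0,1), psd A B;
   the None branch is never reached in that case) *)
Definition tele (n : nat) (a : R) (A B : Mat) : R :=
  match relent n A (madd (mscale a A) (mscale (1 - a) B)) with
  | Some r => r / (- ln a)
  | None => 0
  end.

(* scalar telescopic relative entropy S_a(b||c) (0 log 0 = 0 automatic since b * _) *)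
Definition tele_sc (a b c : R) : R :=
  b * (ln b - ln (a * b + (1 - a) * c)) / (- ln a).

Definition tdist (n : nat) (A B : Mat) : R :=
  re (trace n (funcalc n (fun x => Rmax x 0) (madd A (mscale (-1) B)))).

(* Main.v *)
(* For positive definite X and Y, set R = (X + u)^-1 and S = (Y + u)^-1. The
   nonnegativity of (R - S)(Y + u)(R - S) is the convexity of the inverse, and
   integrating it over u > 0 linearizes Tr rho log Y at X. Applied to Y / c
   instead of Y, where Y <= X + D and X >= a rho, this gives
   Tr rho (log Y - log X) <= log c with c = 1 + Tr D / a: in the eigenbasis of X
   the error terms are q_j x_j / (x_j + u)^2, they integrate to the q_j, and
   this value of c is the one for which the q_j sum to zero. With
   X = a rho + (1 - a) sigma_1, Y = a rho + (1 - a) sigma_2 and D the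
   (1 - a)-multiple of the negative part of sigma_1 - sigma_2 this is the first
   inequality. In the orthogonal case a Y rho = (a + (1 - a) t) rho X, so the
   entries of rho between eigenvectors of Y and X vanish unless the eigenvalues
   are in the ratio (a + (1 - a) t) / a. *)
Require Import Defs.
From Stdlib Require Import Reals.
From Stdlib Require Import ClassicalEpsilon.
From mathcomp Require Import all_boot all_order all_algebra.
From mathcomp Require Import complex Rstruct ring lra.

Set Implicit Arguments.
Unset Strict Implicit.
Unset Printing Implicit Defensive.
Import Order.TTheory GRing.Theory Num.Theory.

(** * Sums of logarithms *)

Section Analysis.
Local Open Scope ring_scope.

Lemma derivable_pt_lim_bigsum (I : Type) (s : seq I) (f : I -> R -> R)
    (df : I -> R) (u : R) :
  (forall i, derivable_pt_lim (f i) u (df i)) ->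
  derivable_pt_lim (fun v => \sum_(i <- s) f i v) u (\sum_(i <- s) df i).
Proof.
move=> dfi; elim: s => [|i s IHs].
  rewrite big_nil.
  apply: (@derivable_pt_lim_ext (fct_cte 0)); last exact: derivable_pt_lim_const.
  by move=> v; rewrite big_nil.
rewrite big_cons.
apply: (@derivable_pt_lim_ext (plus_fct (f i) (fun v => \sum_(j <- s) f j v))).
  by move=> v; rewrite big_cons.
exact: derivable_pt_lim_plus.
Qed.

(** The point [u = 0] is included because the mean value theorem is later applied on an interval
    starting at 0. There the logarithm is singular when [y = 0], and the last hypothesis makes the
    whole term vanish identically in that case. *)
Lemma derivable_pt_lim_scale_ln (p y u : R) :
  0 <= y -> 0 <= u -> (y = 0 -> p = 0) ->
  derivable_pt_lim (fun v => p * ln (y + v)%R) u (p / (y + u)).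
Proof.
move=> y0 u0 yp; have [ye|yn] := eqVneq y 0.
  rewrite (yp ye) mul0r.
  apply: (@derivable_pt_lim_ext (fct_cte 0)); last exact: derivable_pt_lim_const.
  by move=> v; rewrite mul0r.
have yu : 0 < y + u by rewrite ltr_pwDl // lt0r yn.
apply: (@derivable_pt_lim_ext (mult_real_fct p (comp ln (plus_fct (fct_cte y) id)))) => //.
have -> : p / (y + u) = Rmult p (Rmult (Rinv (Rplus y u)) (Rplus 0 1)).
  by rewrite !RealsE /= add0r mulr1.
apply: derivable_pt_lim_scal; apply: derivable_pt_lim_comp.
  by apply: derivable_pt_lim_plus; [exact: derivable_pt_lim_const|exact: derivable_pt_lim_id].
by apply: derivable_pt_lim_ln; apply/RltP.
Qed.

Lemma derivable_pt_lim_scale_inv (q x u : R) :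
  0 <= x -> 0 <= u ->
  derivable_pt_lim (fun v => q * x / (x + v)) u (- (q * x / (x + u) ^+ 2)).
Proof.
move=> x0 u0; have [xe|xn] := eqVneq x 0.
  rewrite xe mulr0 mul0r oppr0.
  apply: (@derivable_pt_lim_ext (fct_cte 0)); last exact: derivable_pt_lim_const.
  by move=> v; rewrite mul0r.
have xu : x + u != 0 by rewrite gt_eqF // ltr_pwDl // lt0r xn.
apply: (@derivable_pt_lim_ext (div_fct (fct_cte (q * x)) (plus_fct (fct_cte x) id))) => //.
have -> : - (q * x / (x + u) ^+ 2) =
    Rdiv (Rminus (Rmult 0 (Rplus x u)) (Rmult (Rplus 0 1) (q * x))) (Rsqr (Rplus x u)).
  rewrite /Rsqr !RealsE /= mul0r !add0r mul1r expr2.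
  by rewrite mulNr.
apply: derivable_pt_lim_div; last exact/eqP.
  exact: derivable_pt_lim_const.
by apply: derivable_pt_lim_plus; [exact: derivable_pt_lim_const|exact: derivable_pt_lim_id].
Qed.

Lemma ler_ln (u v : R) : 0 < u -> u <= v -> ln u <= ln v.
Proof.
move=> u0; rewrite le_eqVlt => /orP[/eqP->//|uv].
by apply/ltW/RltP/ln_increasing; apply/RltP.
Qed.

Lemma ln_le_subr1 (u : R) : 0 < u -> ln u <= u - 1.
Proof.
move=> u0; have [->|un] := eqVneq u 1; first by rewrite ln_1 subrr.
have ln0 : ln u <> 0.
  by move=> l0; case/eqP: un; rewrite -(@exp_ln u) ?l0 ?exp_0 //; exact/RltP.
have /RltP := exp_ineq1 _ ln0; rewrite exp_ln; last exact/RltP.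
by rewrite !RealsE /= => /ltW; rewrite lerBrDl.
Qed.

Lemma logsE (u : R) : 0 < u -> logs u = ln u.
Proof. by move=> u0; rewrite /logs; case: Rlt_dec => // /RltP; rewrite u0. Qed.

Lemma scale_logsE (p y : R) : 0 <= y -> (y = 0 -> p = 0) -> p * logs y = p * ln y.
Proof.
rewrite le_eqVlt => /orP[/eqP <- -> //|y0 _]; first by rewrite !mul0r.
by rewrite logsE.
Qed.

(* The difference of the two sides, with every [ln y] replaced by
   [ln (y + u)], is nondecreasing in [u] up to the correction
   [\sum q x / (x + u)], and tends to [0] at infinity. *)
Lemma sum_logs_le (I : finType) (p y r x q : I -> R) :
  (forall i, 0 <= p i) -> (forall i, 0 <= y i) -> (forall i, y i = 0 -> p i = 0) ->
  (forall i, 0 <= r i) -> (forall i, 0 <= x i) -> (forall i, x i = 0 -> r i = 0) ->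
  (forall i, x i = 0 -> 0 <= q i) ->
  \sum_i p i = \sum_i r i -> \sum_i q i = 0 ->
  (forall u : R, 0 < u -> \sum_i r i / (x i + u) - \sum_i q i * x i / (x i + u) ^+ 2
                      <= \sum_i p i / (y i + u)) ->
  \sum_i p i * logs (y i) <= \sum_i r i * logs (x i).
Proof.
move=> p0 y0 yp r0 x0 xr xq pr q0 resolv.
pose H (u : R) : R := \sum_i p i * ln (y i + u)%R - \sum_i r i * ln (x i + u)%R
            - \sum_i q i * x i / (x i + u).
pose H' (u : R) : R := \sum_i p i / (y i + u) - \sum_i r i / (x i + u)
            - \sum_i - (q i * x i / (x i + u) ^+ 2).
have dH (u : R) : 0 <= u -> derivable_pt_lim H u (H' u).
  move=> u0.
  apply: (@derivable_pt_lim_minus (fun u : R =>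
    \sum_i p i * ln (y i + u)%R - \sum_i r i * ln (x i + u)%R)).
    apply: (@derivable_pt_lim_minus (fun u : R => \sum_i p i * ln (y i + u)%R)).
      by apply: derivable_pt_lim_bigsum => i; exact: derivable_pt_lim_scale_ln (yp i).
    by apply: derivable_pt_lim_bigsum => i; exact: derivable_pt_lim_scale_ln (xr i).
  by apply: derivable_pt_lim_bigsum => i; exact: derivable_pt_lim_scale_inv.
(* The mean value theorem yields an interior point [v > 0], and there [resolv] says exactly that
   [H' v] is nonnegative. *)
have Hmono (u : R) : 0 < u -> H 0 <= H u.
  move=> u0; have [||v [eqH [/RltP v0 _]]] := @MVT_cor2 H H' 0 u.
  - exact/RltP.
  - by move=> v [/RleP v0 _]; exact: dH.
  rewrite -subr_ge0 -RminusE eqH !RealsE subr0 mulr_ge0 //; last exact: ltW.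
  rewrite /H' sumrN opprK.
  by have := resolv _ v0; lra.
(* For large [u], the terms in [ln u] cancel since [p] and [r] have the same sum. The rest is at
   most [K / u], by [ln (w + u) <= ln u + w / u] for the [y] terms, monotonicity of [ln] for the [x]
   terms and [|q|] for the correction. *)
pose K : R := \sum_i p i * y i + \sum_i `|q i| * x i.
have K0 : 0 <= K by rewrite addr_ge0 // sumr_ge0 // => i _; rewrite mulr_ge0.
have HK (u : R) : 0 < u -> H u <= K / u.
  move=> u0.
  have lnD (w : R) : 0 <= w -> ln (w + u)%R <= ln u + w / u.
    move=> w0; have wu : 0 < w + u by rewrite ltr_wpDl.
    have -> : w + u = Rmult u ((w + u) / u)%R by rewrite RmultE mulrC divfK ?gt_eqF.
    rewrite ln_mult; [|exact/RltP|exact/RltP/divr_gt0].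
    rewrite RplusE lerD2l; apply: le_trans (ln_le_subr1 _) _; first exact: divr_gt0.
    by rewrite mulrDl divff ?gt_eqF // addrK.
  have le1 : \sum_i p i * ln (y i + u)%R <= \sum_i (p i * ln u + p i * y i / u).
    by apply: ler_sum => i _; rewrite -mulrA -mulrDr ler_wpM2l // lnD.
  have le2 : \sum_i r i * ln u <= \sum_i r i * ln (x i + u)%R.
    by apply: ler_sum => i _; rewrite ler_wpM2l // ler_ln // lerDr.
  have le3 : - \sum_i q i * x i / (x i + u) <= \sum_i `|q i| * x i / u.
    rewrite -sumrN; apply: ler_sum => i _; rewrite -!mulrA -mulNr.
    have xu0 : 0 <= x i / (x i + u) by rewrite divr_ge0 ?addr_ge0 // ltW.
    apply: (@le_trans _ _ (`|q i| * (x i / (x i + u)))).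
      by rewrite ler_wpM2r // -normrN ler_norm.
    rewrite ler_wpM2l // ler_wpM2l // lef_pV2 ?posrE ?ltr_wpDl //.
    by rewrite lerDr.
  move: le1 le2 le3; rewrite big_split /= -!mulr_suml pr /H /K mulrDl.
  by set S := \sum_i r i; lra.
have H0 : H 0 <= 0.
  rewrite leNgt; apply/negP => H0.
  (* At this point [K / u = K * H 0 / (K + 1)], which is less than [H 0] and so contradicts
     monotonicity. *)
  have u0 : 0 < (K + 1) / H 0 by rewrite divr_gt0 // ltr_wpDl.
  have := le_trans (Hmono _ u0) (HK _ u0).
  rewrite invf_div mulrA ler_pdivlMr ?ltr_wpDl // mulrDr mulr1 [K * _]mulrC.
  by rewrite gerDl leNgt H0.
have HE : H 0 = \sum_i p i * logs (y i) - \sum_i r i * logs (x i)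
          - \sum_i q i * x i / (x i + 0).
  rewrite /H; congr (_ - _ - _); apply: eq_bigr => i _; rewrite addr0.
    by rewrite scale_logsE //; exact: yp.
  by rewrite scale_logsE //; exact: xr.
(* At [u = 0] each correction term equals [q i] if [x i] is nonzero. Otherwise it is 0 by the
   convention for division, and [q i] is nonnegative there. *)
have : \sum_i q i * x i / (x i + 0) <= \sum_i q i.
  apply: ler_sum => i _; rewrite addr0.
  have [xe|xn] := eqVneq (x i) 0; first by rewrite xe mulr0 mul0r xq.
  by rewrite mulfK.
by move: H0; rewrite HE q0; lra.
Qed.
End Analysis.

(** * Hermitian and positive semidefinite matrices *)

Section ComplexMatrices.
Local Open Scope ring_scope.
Local Open Scope sesquilinear_scope.
Variable R : rcfType.
Local Notation C := R[i].
Local Notation "x %:C" := (real_complex R x) : ring_scope.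

Definition retr n (A : 'M[C]_n) : R := complex.Re (\tr A).

Definition rdiag n (d : 'I_n -> R) : 'M[C]_n := diag_mx (\row_i (d i)%:C).

Definition spec n (V : 'M[C]_n) (d : 'I_n -> R) : 'M[C]_n := V *m rdiag d *m V^t*.

(** Positive semidefiniteness in factored form: stability under congruence and positivity of the
    trace of a product become short computations with the factors. *)
Definition gram n (A : 'M[C]_n) := exists P : 'M[C]_n, A = P^t* *m P.

Lemma ReD (x y : C) : complex.Re (x + y) = complex.Re x + complex.Re y.
Proof. by case: x; case: y. Qed.

Lemma ReB (x y : C) : complex.Re (x - y) = complex.Re x - complex.Re y.
Proof. by case: x; case: y. Qed.

Lemma ReZ (r : R) (x : C) : complex.Re (r%:C * x) = r * complex.Re x.
Proof. by case: x => a b /=; rewrite mul0r subr0. Qed.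

Lemma Re_sum (I : finType) (F : I -> C) :
  complex.Re (\sum_i F i) = \sum_i complex.Re (F i).
Proof. exact: (big_morph _ ReD). Qed.

Lemma Re_conjM_ge0 (x : C) : 0 <= complex.Re (x^* * x).
Proof. by case: x => a b /=; rewrite mulNr opprK addr_ge0 // -expr2 sqr_ge0. Qed.

Lemma adjE m n (A : 'M[C]_(m, n)) i j : (A^t*) i j = (A j i)^*.
Proof. by rewrite !mxE. Qed.

Lemma adjM m n p (A : 'M[C]_(m, n)) (B : 'M[C]_(n, p)) :
  (A *m B)^t* = B^t* *m A^t*.
Proof. by rewrite trmx_mul map_mxM. Qed.

Lemma adjB m n (A B : 'M[C]_(m, n)) : (A - B)^t* = A^t* - B^t*.
Proof. by rewrite linearB map_mxB. Qed.

Lemma conjC_real (r : R) : (r%:C)^* = r%:C.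
Proof. exact: conjc_real. Qed.

Lemma adjZ m n (r : R) (A : 'M[C]_(m, n)) : (r%:C *: A)^t* = r%:C *: A^t*.
Proof. by apply/matrixP => i j; rewrite !mxE rmorphM; congr (_ * _); exact: conjc_real. Qed.

Lemma normal_diag_ge0 m n (P : 'M[C]_(m, n)) i : 0 <= complex.Re ((P^t* *m P) i i).
Proof. by rewrite mxE Re_sum sumr_ge0 // => j _; rewrite adjE Re_conjM_ge0. Qed.

(** The diagonal entries of [P^t* *m P] are the squared norms of the columns of [P]. *)
Lemma normal_diag_eq0 m n (P : 'M[C]_(m, n)) :
  (forall i, complex.Re ((P^t* *m P) i i) = 0) -> P = 0.
Proof.
move=> P0; apply/matrixP => i j; rewrite mxE.
have := P0 j; rewrite mxE Re_sum => /eqP.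
rewrite psumr_eq0 => [/allP/(_ i)|k _]; last by rewrite adjE Re_conjM_ge0.
rewrite mem_index_enum adjE => /(_ isT); case: (P i j) => a b /=.
rewrite mulNr opprK paddr_eq0 -?expr2 ?sqr_ge0 // !sqrf_eq0.
by move=> /andP[/eqP-> /eqP->].
Qed.

Section Dim.
Variable n : nat.
Implicit Types (A B V W : 'M[C]_n) (d e : 'I_n -> R).

Lemma retrD A B : retr (A + B) = retr A + retr B.
Proof. by rewrite /retr mxtraceD ReD. Qed.

Lemma retrB A B : retr (A - B) = retr A - retr B.
Proof. by rewrite /retr linearB ReB. Qed.

Lemma retrZ r A : retr (r%:C *: A) = r * retr A.
Proof. by rewrite /retr mxtraceZ ReZ. Qed.

Lemma retrC A B : retr (A *m B) = retr (B *m A).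
Proof. by rewrite /retr mxtrace_mulC. Qed.

Lemma retrE A : retr A = \sum_i complex.Re (A i i).
Proof. by rewrite /retr /mxtrace Re_sum. Qed.

Lemma retr_rdiagl d A : retr (rdiag d *m A) = \sum_i d i * complex.Re (A i i).
Proof.
by rewrite retrE; apply: eq_bigr => i _; rewrite mul_diag_mx !mxE ReZ.
Qed.

Lemma retr_rdiag d A : retr (A *m rdiag d) = \sum_i complex.Re (A i i) * d i.
Proof. by rewrite retrC retr_rdiagl; apply: eq_bigr => i _; rewrite mulrC. Qed.

Lemma rdiagM d e : rdiag d *m rdiag e = rdiag (fun i => d i * e i).
Proof.
rewrite /rdiag mulmx_diag; congr diag_mx; apply/rowP => i.
by rewrite !mxE rmorphM.
Qed.

Lemma rdiag_adj d : (rdiag d)^t* = rdiag d.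
Proof.
apply/matrixP => i j; rewrite adjE !mxE eq_sym.
by case: eqVneq => [->|_]; rewrite ?mulr1n ?conjC_real ?mulr0n ?conjC0.
Qed.

Lemma rdiag1 d : (forall i, d i = 1) -> rdiag d = 1%:M.
Proof.
by move=> d1; apply/matrixP => i j; rewrite !mxE d1 rmorph1.
Qed.

Lemma rdiag_affine k u d : rdiag (fun i => k * d i + u) = k%:C *: rdiag d + u%:C *: 1%:M.
Proof.
apply/matrixP => i j; rewrite !mxE rmorphD rmorphM mulrnDl -!mulrnAr.
by congr (_ + _); rewrite mulr_natr.
Qed.

Lemma unitary_mulVmx V : V^t* *m V = 1%:M -> V *m V^t* = 1%:M.
Proof. exact: mulmx1C. Qed.

Lemma spec_affine V k u d : V^t* *m V = 1%:M ->
  spec V (fun i => k * d i + u) = k%:C *: spec V d + u%:C *: 1%:M.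
Proof.
move=> /unitary_mulVmx V1.
by rewrite /spec rdiag_affine mulmxDr mulmxDl -!scalemxAr -!scalemxAl mulmx1 V1.
Qed.

Lemma specM V d e : V^t* *m V = 1%:M ->
  spec V d *m spec V e = spec V (fun i => d i * e i).
Proof.
move=> V1; rewrite /spec -rdiagM !mulmxA; congr (_ *m _ *m _).
by rewrite -[LHS]mulmxA V1 mulmx1.
Qed.

Lemma spec1 V d : V^t* *m V = 1%:M -> (forall i, d i = 1) -> spec V d = 1%:M.
Proof. by move=> /unitary_mulVmx V1 d1; rewrite /spec rdiag1 // mulmx1. Qed.

Lemma spec_adj V d : (spec V d)^t* = spec V d.
Proof. by rewrite /spec !adjM rdiag_adj trmxCK mulmxA. Qed.

Lemma retr_specr V d A :
  retr (A *m spec V d) = \sum_i complex.Re ((V^t* *m A *m V) i i) * d i.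
Proof. by rewrite /spec !mulmxA retrC !mulmxA retr_rdiag. Qed.

Lemma gram_spec V d : (forall i, 0 <= d i) -> gram (spec V d).
Proof.
move=> d0; exists (rdiag (fun i => Num.sqrt (d i)) *m V^t*).
rewrite adjM rdiag_adj trmxCK /spec [RHS]mulmxA -[in RHS](mulmxA V) rdiagM.
congr (_ *m diag_mx _ *m _); apply/rowP => i.
by rewrite !mxE -expr2 sqr_sqrtr.
Qed.

Lemma gram_congr A B : gram A -> gram (B^t* *m A *m B).
Proof. by move=> [P ->]; exists (P *m B); rewrite adjM !mulmxA. Qed.

Lemma gram_adj A : gram A -> A^t* = A.
Proof. by move=> [P ->]; rewrite adjM trmxCK. Qed.

Lemma gramZ r A : 0 <= r -> gram A -> gram (r%:C *: A).
Proof.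
move=> r0 [P ->]; exists ((Num.sqrt r)%:C *: P).
rewrite adjZ -scalemxAl -scalemxAr scalerA.
by rewrite -rmorphM -expr2 sqr_sqrtr.
Qed.

Lemma gram_diag_ge0 A i : gram A -> 0 <= complex.Re (A i i).
Proof. by move=> [P ->]; exact: normal_diag_ge0. Qed.

(** By cyclicity, the trace of [P^t* *m P *m Q^t* *m Q] is the squared Hilbert-Schmidt norm of
    [P *m Q^t*]. *)
Lemma retr_gram_ge0 A B : gram A -> gram B -> 0 <= retr (A *m B).
Proof.
move=> [P ->] [Q ->]; rewrite !mulmxA retrC !mulmxA retrE sumr_ge0 // => i _.
by apply: gram_diag_ge0; exists (P *m Q^t*); rewrite adjM trmxCK !mulmxA.
Qed.

(** The same squared norm vanishes, so [P *m Q^t* = 0], and this is the middle of the product. *)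
Lemma gram_orth A B : gram A -> gram B -> retr (A *m B) = 0 -> A *m B = 0.
Proof.
move=> [P ->] [Q ->]; rewrite !mulmxA retrC !mulmxA => AB0.
have PQ0 : P *m Q^t* = 0.
  have E : (P *m Q^t*)^t* *m (P *m Q^t*) = Q *m P^t* *m P *m Q^t*.
    by rewrite adjM trmxCK !mulmxA.
  apply: normal_diag_eq0 => i; apply/eqP; move/eqP: AB0; rewrite retrE -E.
  rewrite psumr_eq0 => [/allP/(_ i)|k _]; first by rewrite mem_index_enum => /(_ isT).
  exact: normal_diag_ge0.
by rewrite -[_ *m P *m _]mulmxA PQ0 mulmx0 mul0mx.
Qed.

Lemma spec_diag V d : V^t* *m V = 1%:M -> V^t* *m spec V d *m V = rdiag d.
Proof.
by move=> V1; rewrite /spec !mulmxA V1 mul1mx -mulmxA V1 mulmx1.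
Qed.

Lemma rdiag_diag d i : complex.Re (rdiag d i i) = d i.
Proof. by rewrite !mxE eqxx. Qed.

(** Scalar elimination for the next lemma. With [E = (X + u)^-1], the numbers [s1], [s2], [s3], [T]
    are the traces of [rho] against [E], [E E], [E X E], [E Y E]; [s4] and [T'] are those of [D]
    against [E X E] and [E rho E]; [sS] is that of [rho] against the other resolvent. The three
    inequalities are the nonnegative traces, the equation is [E = u E E + E X E], and [T], [T'] are
    eliminated. *)
Lemma resolvent_bounds_combine (a c u T T' sS s1 s2 s3 s4 : R) :
  0 < a -> 0 < c ->
  0 <= c^-1 * T + u * s2 - s1 - s1 + sS -> 0 <= s3 + T' - T -> 0 <= s4 - a * T' ->
  s1 = u * s2 + s3 -> s1 - ((c^-1 - 1) * s3 + s4 / (c * a)) <= sS.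
Proof.
move=> a0 c0 h1 h2 h3 s1E.
have T's : T' <= s4 / a by rewrite ler_pdivlMr // mulrC -subr_ge0.
have cT : c^-1 * T <= c^-1 * (s3 + s4 / a) by rewrite ler_wpM2l ?invr_ge0 ?(ltW c0) //; lra.
have -> : s4 / (c * a) = c^-1 * (s4 / a) by rewrite invfM mulrCA.
move: cT h1; rewrite s1E mulrDr; lra.
Qed.

(* The three nonnegative traces are [Tr rho (R - S) B (R - S)] with
   [R = (X + u)^-1], [S = B^-1 = (Y / c + u)^-1] (operator convexity of the
   inverse), [Tr R rho R (X + D - Y)], and [Tr R (X - a rho) R D]. *)
Lemma resolvent_trace_le_diag (V rho D : 'M[C]_n) (y x r q : 'I_n -> R) (a c u : R) :
  V^t* *m V = 1%:M -> (forall i, 0 <= y i) -> (forall i, 0 <= x i) ->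
  0 < a -> 0 < c -> 0 < u ->
  gram rho -> gram D -> gram (rdiag x - a%:C *: rho) ->
  gram (rdiag x + D - spec V y) ->
  (forall i, r i = complex.Re (rho i i)) ->
  (forall i, q i = (c^-1 - 1) * r i + complex.Re (D i i) / (c * a)) ->
  \sum_i r i / (x i + u) - \sum_i q i * x i / (x i + u) ^+ 2
  <= \sum_i complex.Re ((V^t* *m rho *m V) i i) / (y i / c + u).
Proof.
move=> V1 y0 x0 a0 c0 u0 grho gD gX gY rE qE.
have xu i : x i + u != 0 by rewrite gt_eqF // ltr_wpDl.
have ycu i : y i / c + u != 0 by rewrite gt_eqF // ltr_wpDl // divr_ge0 // ltW.
pose e i := (x i + u)^-1; pose f i := (y i / c + u)^-1.
pose E := rdiag e; pose S := spec V f; pose X := rdiag x; pose Y := spec V y.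
pose B := spec V (fun i => c^-1 * y i + u).
have BE : B = c^-1%:C *: Y + u%:C *: 1%:M by exact: spec_affine.
have BS : B *m S = 1%:M.
  by rewrite specM // spec1 // => i; rewrite /f [c^-1 * _]mulrC divff.
have SB : S *m B = 1%:M by exact: mulmx1C.
have EE : E^t* = E by exact: rdiag_adj.
have gB : gram B.
  by apply: gram_spec => i; rewrite addr_ge0 ?mulr_ge0 ?invr_ge0 // ltW.
have SS : S^t* = S by exact: spec_adj.
have rhoS : retr (rho *m S) = \sum_i complex.Re ((V^t* *m rho *m V) i i) / (y i / c + u).
  exact: retr_specr.
have rhoE : retr (rho *m E) = \sum_i r i * e i.
  by rewrite retr_rdiag; apply: eq_bigr => i _; rewrite rE.
have rhoEE : retr (rho *m (E *m E)) = \sum_i r i * (e i * e i).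
  by rewrite rdiagM retr_rdiag; apply: eq_bigr => i _; rewrite rE.
have rhoX : retr (rho *m (E *m X *m E)) = \sum_i r i * (e i * x i * e i).
  by rewrite rdiagM rdiagM retr_rdiag; apply: eq_bigr => i _; rewrite rE.
have DX : retr (D *m (E *m X *m E)) = \sum_i complex.Re (D i i) * (e i * x i * e i).
  by rewrite rdiagM rdiagM retr_rdiag.
rewrite -/X -/Y in gX gY.
(* The traces against functions of [X] are already expanded in its eigenbasis; what follows uses
   only the recorded relations between these matrices. *)
clearbody X Y E S B.
have pos1 : 0 <= retr (rho *m (E *m B *m E - E - E + S)).
  have -> : E *m B *m E - E - E + S = (E - S)^t* *m B *m (E - S).
    rewrite adjB EE SS mulmxBl SB mulmxBr !mulmxBl !mul1mx.
    by rewrite -(mulmxA E B S) BS mulmx1 opprB addrA addrAC.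
  exact/retr_gram_ge0/gram_congr.
have pos2 : 0 <= retr (E *m rho *m E *m (X + D - Y)).
  by apply: retr_gram_ge0 => //; rewrite -{1}EE; exact: gram_congr.
have pos3 : 0 <= retr (D *m (E *m (X - a%:C *: rho) *m E)).
  by apply: retr_gram_ge0 => //; rewrite -{1}EE; exact: gram_congr.
have pos1E : retr (rho *m (E *m B *m E - E - E + S)) =
    retr (rho *m (E *m B *m E)) - retr (rho *m E) - retr (rho *m E) + retr (rho *m S).
  by rewrite mulmxDr mulmxBr mulmxBr retrD !retrB.
have EBE : E *m B *m E = c^-1%:C *: (E *m Y *m E) + u%:C *: (E *m E).
  by rewrite BE mulmxDr mulmxDl -!scalemxAr -!scalemxAl mulmx1.
have BEE : retr (rho *m (E *m B *m E)) =
    c^-1 * retr (rho *m (E *m Y *m E)) + u * retr (rho *m (E *m E)).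
  by rewrite EBE mulmxDr -!scalemxAr retrD !retrZ.
have swap M : retr (E *m rho *m E *m M) = retr (rho *m (E *m M *m E)).
  by rewrite -!mulmxA [LHS]retrC -!mulmxA.
have pos2E : retr (E *m rho *m E *m (X + D - Y)) =
    retr (rho *m (E *m X *m E)) + retr (D *m (E *m rho *m E)) - retr (rho *m (E *m Y *m E)).
  by rewrite mulmxBr mulmxDr retrB retrD !swap -(swap D) [retr (_ *m D)]retrC.
have pos3E : retr (D *m (E *m (X - a%:C *: rho) *m E)) =
    retr (D *m (E *m X *m E)) - a * retr (D *m (E *m rho *m E)).
  by rewrite mulmxBr !mulmxBl mulmxBr -scalemxAr -scalemxAl -scalemxAr retrB retrZ.
rewrite pos1E BEE rhoS rhoE rhoEE in pos1.
rewrite pos2E rhoX in pos2; rewrite pos3E DX in pos3.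
move: pos1 pos2 pos3.
set T := retr (rho *m (E *m Y *m E)); set T' := retr (D *m (E *m rho *m E)).
set sS := \sum_i _ / (y i / c + u).
set s1 := \sum_i r i * e i; set s2 := \sum_i r i * (e i * e i).
set s3 := \sum_i r i * (e i * x i * e i).
set s4 := \sum_i complex.Re (D i i) * (e i * x i * e i) => pos1 pos2 pos3.
change (s1 - \sum_i q i * x i / (x i + u) ^+ 2 <= sS).
have -> : \sum_i q i * x i / (x i + u) ^+ 2
    = (c^-1 - 1) * s3 + s4 / (c * a).
  rewrite mulr_sumr mulr_suml -big_split /=; apply: eq_bigr => i _.
  by rewrite qE /e expr2 !invfM; ring.
have s1E : s1 = u * s2 + s3.
  rewrite mulr_sumr -big_split /=; apply: eq_bigr => i _.
  by rewrite /e; field.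
exact: resolvent_bounds_combine pos1 pos2 pos3 s1E.
Qed.

(** Conjugation by [W] reduces to the diagonal case: positivity survives congruence, and [V] turns
    into [W^t* *m V]. *)
Lemma resolvent_trace_le (V W rho D : 'M[C]_n) (y x r q : 'I_n -> R) (a c u : R) :
  V^t* *m V = 1%:M -> W^t* *m W = 1%:M ->
  (forall i, 0 <= y i) -> (forall i, 0 <= x i) ->
  0 < a -> 0 < c -> 0 < u ->
  gram rho -> gram D -> gram (spec W x - a%:C *: rho) ->
  gram (spec W x + D - spec V y) ->
  (forall i, r i = complex.Re ((W^t* *m rho *m W) i i)) ->
  (forall i, q i = (c^-1 - 1) * r i + complex.Re ((W^t* *m D *m W) i i) / (c * a)) ->
  \sum_i r i / (x i + u) - \sum_i q i * x i / (x i + u) ^+ 2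
  <= \sum_i complex.Re ((V^t* *m rho *m V) i i) / (y i / c + u).
Proof.
move=> V1 W1 y0 x0 a0 c0 u0 grho gD gX gY rE qE.
have W1' := unitary_mulVmx W1.
pose V' := W^t* *m V; pose rho' := W^t* *m rho *m W.
have V'1 : V'^t* *m V' = 1%:M.
  by rewrite /V' adjM trmxCK mulmxA -(mulmxA _ W) W1' mulmx1.
have rhoE : V'^t* *m rho' *m V' = V^t* *m rho *m V.
  rewrite /V' /rho' adjM trmxCK !mulmxA -(mulmxA _ W) W1' mulmx1.
  by rewrite -(mulmxA _ W) W1' mulmx1.
rewrite -rhoE; apply: (resolvent_trace_le_diag V'1 y0 x0 a0 c0 u0 _ _ _ _ rE qE).
- exact: gram_congr.
- exact: gram_congr.
- have -> : rdiag x - a%:C *: rho' = W^t* *m (spec W x - a%:C *: rho) *m W.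
    by rewrite mulmxBr mulmxBl spec_diag // -scalemxAr -scalemxAl.
  exact: gram_congr.
have -> : rdiag x + W^t* *m D *m W - spec V' y =
    W^t* *m (spec W x + D - spec V y) *m W.
  rewrite mulmxBr mulmxBl mulmxDr mulmxDl spec_diag //; congr (_ - _).
  by rewrite /spec /V' adjM trmxCK !mulmxA.
exact: gram_congr.
Qed.

Lemma retr_congr_unitary V A : V^t* *m V = 1%:M -> retr (V^t* *m A *m V) = retr A.
Proof.
by move=> /unitary_mulVmx V1; rewrite retrC mulmxA V1 mul1mx.
Qed.

Lemma entryD m p (A B : 'M[C]_(m, p)) i j : (A + B) i j = A i j + B i j.
Proof. by rewrite mxE. Qed.

Lemma entryB m p (A B : 'M[C]_(m, p)) i j : (A - B) i j = A i j - B i j.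
Proof. by rewrite !mxE. Qed.

Lemma entryZ m p (k : C) (A : 'M[C]_(m, p)) i j : (k *: A) i j = k * A i j.
Proof. by rewrite mxE. Qed.

Lemma diag_decomp V a d A i : V^t* *m V = 1%:M ->
  d i = complex.Re ((V^t* *m (spec V d - a%:C *: A) *m V) i i)
        + a * complex.Re ((V^t* *m A *m V) i i).
Proof.
move=> V1; rewrite mulmxBr mulmxBl spec_diag // -scalemxAr -scalemxAl.
by rewrite entryB entryZ ReB ReZ rdiag_diag subrK.
Qed.

(** This lemma and the next expand traces against functions of two matrices with different
    eigenbases over one common family of weights, so that they can be compared term by term. *)
Lemma retr_spec_mixed V W d A : V^t* *m V = 1%:M -> W^t* *m W = 1%:M ->
  retr (A *m spec V d) =
  \sum_i d i * \sum_j complex.Re ((V^t* *m A *m W) i j * (W^t* *m V) j i).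
Proof.
move=> V1 W1; rewrite retr_specr; apply: eq_bigr => i _; rewrite mulrC -Re_sum.
congr (_ * complex.Re _); have <- : (V^t* *m A *m W) *m (W^t* *m V) = V^t* *m A *m V.
  by rewrite -!mulmxA (mulmxA W) (unitary_mulVmx W1) mul1mx.
by rewrite mxE.
Qed.

Lemma retr_spec_mixedr V W d A : V^t* *m V = 1%:M -> W^t* *m W = 1%:M ->
  retr (A *m spec W d) =
  \sum_i \sum_j d j * complex.Re ((V^t* *m A *m W) i j * (W^t* *m V) j i).
Proof.
move=> V1 W1; rewrite exchange_big /= retr_specr.
apply: eq_bigr => i _; rewrite mulrC -mulr_sumr -Re_sum.
congr (_ * complex.Re _); have <- : (W^t* *m V) *m (V^t* *m A *m W) = W^t* *m A *m W.
  by rewrite -!mulmxA (mulmxA V) (unitary_mulVmx V1) mul1mx.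
by rewrite mxE; apply: eq_bigr => j _; rewrite mulrC.
Qed.

(** Read between the two eigenbases, the intertwining relation says
    [a * y i * M i j = b * M i j * x j]. *)
Lemma mixed_eigenvalues V W A (x y : 'I_n -> R) a b i j :
  V^t* *m V = 1%:M -> W^t* *m W = 1%:M ->
  a%:C *: (spec V y *m A) = b%:C *: (A *m spec W x) ->
  (V^t* *m A *m W) i j != 0 -> a * y i = b * x j.
Proof.
move=> V1 W1 E; set M := V^t* *m A *m W => Mij.
have : a%:C *: (rdiag y *m M) = b%:C *: (M *m rdiag x).
  have -> : rdiag y *m M = V^t* *m (spec V y *m A) *m W.
    by rewrite /spec !mulmxA V1 mul1mx.
  have -> : M *m rdiag x = V^t* *m (A *m spec W x) *m W.
    by rewrite /spec !mulmxA -[in RHS]mulmxA W1 mulmx1.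
  by rewrite scalemxAl scalemxAr E -scalemxAr -scalemxAl.
clearbody M.
move/matrixP/(_ i j); rewrite !entryZ mul_diag_mx mul_mx_diag.
rewrite [in LHS]mxE [in RHS]mxE [X in _ * (X * _)]mxE [X in _ = _ * (_ * X)]mxE.
rewrite mulrA [_ * (M i j * _)]mulrCA [RHS]mulrC => /(mulIf Mij).
by rewrite -!rmorphM => /complexI.
Qed.

End Dim.
End ComplexMatrices.

(** * Comparison of traces of logarithms *)

Section TraceLog.
Local Open Scope ring_scope.
Local Open Scope sesquilinear_scope.
Local Notation "x %:C" := (real_complex R x) : ring_scope.
Variable n : nat.
Implicit Types (V W rho D : 'M[R[i]]_n) (x y : 'I_n -> R).

(** In the eigenbasis, [y i] is the sum of two nonnegative diagonal entries, one of which is [a]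
    times that of [rho]. The second conclusion is the support condition under which logarithms at 0
    are harmless. *)
Lemma spec_diag_ge0 V y (a : R) rho : 0 < a -> V^t* *m V = 1%:M ->
  gram rho -> gram (spec V y - a%:C *: rho) ->
  forall i, 0 <= y i /\ (y i = 0 -> complex.Re ((V^t* *m rho *m V) i i) = 0).
Proof.
move=> a0 V1 grho gY i; rewrite (diag_decomp a y rho i V1).
have r0 := gram_diag_ge0 i (gram_congr V grho).
have s0 := gram_diag_ge0 i (gram_congr V gY).
have ar0 := mulr_ge0 (ltW a0) r0.
split=> [|/eqP]; first exact: addr_ge0.
by rewrite paddr_eq0 // => /andP[_]; rewrite mulf_eq0 (gt_eqF a0) => /eqP.
Qed.

Lemma scale_logsZ (p y c : R) : 0 < c -> 0 <= y -> (y = 0 -> p = 0) ->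
  p * logs (y / c)%R = p * logs y - p * ln c.
Proof.
move=> c0; rewrite le_eqVlt => /orP[/eqP <- -> //|y0 _]; first by rewrite !mul0r subr0.
rewrite !logsE ?divr_gt0 // -mulrBr; congr (_ * _).
by rewrite -RmultE -RinvE ln_mult ?ln_Rinv //; apply/RltP; rewrite ?invr_gt0.
Qed.

Lemma trace_log_diff_le V W rho D x y (a : R) :
  0 < a -> V^t* *m V = 1%:M -> W^t* *m W = 1%:M ->
  gram rho -> retr rho = 1 -> gram D ->
  gram (spec W x - a%:C *: rho) -> gram (spec V y - a%:C *: rho) ->
  gram (spec W x + D - spec V y) ->
  retr (rho *m spec V (fun i => logs (y i))) - retr (rho *m spec W (fun i => logs (x i)))
  <= ln (1 + retr D / a)%R.
Proof.
move=> a0 V1 W1 grho trho gD gX gY gXY.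
have xP := spec_diag_ge0 a0 W1 grho gX; have yP := spec_diag_ge0 a0 V1 grho gY.
rewrite !retr_specr.
pose r i := complex.Re ((W^t* *m rho *m W) i i).
pose p i := complex.Re ((V^t* *m rho *m V) i i).
pose s i := complex.Re ((W^t* *m D *m W) i i).
have p0 i : 0 <= p i by apply: gram_diag_ge0; exact: gram_congr.
have r0 i : 0 <= r i by apply: gram_diag_ge0; exact: gram_congr.
have s0 i : 0 <= s i by apply: gram_diag_ge0; exact: gram_congr.
have p1 : \sum_i p i = 1 by rewrite -retrE retr_congr_unitary.
have r1 : \sum_i r i = 1 by rewrite -retrE retr_congr_unitary.
have sD : \sum_i s i = retr D by rewrite -retrE retr_congr_unitary.
have D0 : 0 <= retr D by rewrite -sD; apply: sumr_ge0 => i _; exact: s0.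
pose c : R := 1 + retr D / a.
have c0 : 0 < c by rewrite ltr_pwDl // divr_ge0 // ltW.
have tE : retr D = c * a - a by rewrite mulrDl divfK ?gt_eqF // mul1r addrAC subrr add0r.
pose q i := (c^-1 - 1) * r i + s i / (c * a).
rewrite -/c.
(* Since the [p i] sum to 1, [ln c] is spread over the terms and absorbed by replacing [y i] with
   [y i / c]. *)
have -> : ln c = \sum_i p i * ln c by rewrite -mulr_suml p1 mul1r.
rewrite lerBlDr -lerBlDl -sumrB.
under eq_bigr => i _ do rewrite -(scale_logsZ c0 (yP i).1 (yP i).2).
apply: (@sum_logs_le _ p (fun i => y i / c) r x q p0 _ _ r0).
- by move=> i; rewrite divr_ge0 ?(ltW c0) //; case: (yP i).
- by move=> i /eqP; rewrite mulf_eq0 invr_eq0 (gt_eqF c0) orbF => /eqP; case: (yP i).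
- by move=> i; case: (xP i).
- by move=> i; case: (xP i).
- move=> i xi; rewrite /q /r (xP i).2 // mulr0 add0r divr_ge0 //.
  by rewrite mulr_ge0 ?ltW.
- by rewrite p1.
(* The sum of the [q i] is [c^-1 - 1 + retr D / (c * a)], and [retr D = c * a - a] by the choice of
   [c]. *)
- rewrite big_split /= -mulr_sumr -mulr_suml r1 sD tE mulr1.
  have -> : (c * a - a) / (c * a) = 1 - c^-1.
    by rewrite mulrBl divff ?mulf_neq0 ?gt_eqF // invfM mulrCA divff ?gt_eqF // mulr1.
  by rewrite addrA subrK subrr.
move=> u u0; apply: (resolvent_trace_le V1 W1 _ _ a0 c0 u0 grho gD gX gXY) => // i.
  by case: (yP i).
by case: (xP i).
Qed.

(** Both traces are sums over the weights [P i j], which add up to the trace of [rho]. A nonzero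
    weight forces [a * y i = b * x j], hence a difference of logarithms equal to [ln b - ln a] when
    the eigenvalues are positive. *)
Lemma trace_log_diff_eq V W rho x y (a b : R) :
  0 < a -> 0 < b -> V^t* *m V = 1%:M -> W^t* *m W = 1%:M ->
  gram rho -> retr rho = 1 ->
  gram (spec W x - a%:C *: rho) -> gram (spec V y - a%:C *: rho) ->
  a%:C *: (spec V y *m rho) = b%:C *: (rho *m spec W x) ->
  retr (rho *m spec V (fun i => logs (y i))) - retr (rho *m spec W (fun i => logs (x i)))
  = ln b - ln a.
Proof.
move=> a0 b0 V1 W1 grho trho gX gY E.
have xP := spec_diag_ge0 a0 W1 grho gX; have yP := spec_diag_ge0 a0 V1 grho gY.
pose P i j := complex.Re ((V^t* *m rho *m W) i j * (W^t* *m V) j i).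
have P1 : \sum_i \sum_j P i j = 1.
  rewrite -trho -(mulmx1 rho) -(@spec1 _ _ V (fun=> 1) V1) //.
  by rewrite (retr_spec_mixed _ _ V1 W1); apply: eq_bigr => i _; rewrite mul1r.
rewrite (retr_spec_mixed _ _ V1 W1) (retr_spec_mixedr _ _ V1 W1) -sumrB.
rewrite -[RHS]mulr1 -P1 mulr_sumr; apply: eq_bigr => i _.
rewrite mulr_sumr -sumrB.
have [y0 yp0] := yP i.
have xy j : P i j != 0 -> a * y i = b * x j.
  move=> Pij; apply: (mixed_eigenvalues V1 W1 E); apply: contraNneq Pij => M0.
  by rewrite /P M0 mul0r.
(* For a zero eigenvalue both sides vanish: the weights of the row sum to a diagonal entry of [rho]
   that is 0, and a nonzero weight gives [x j = 0], so that the two logarithms agree. *)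
have [yi|yi] := eqVneq (y i) 0.
  have Pi0 : \sum_j P i j = 0.
    rewrite -[RHS](yp0 yi) -Re_sum; congr complex.Re.
    have <- : (V^t* *m rho *m W) *m (W^t* *m V) = V^t* *m rho *m V.
      by rewrite -!mulmxA (mulmxA W) (unitary_mulVmx W1) mul1mx.
    by rewrite mxE.
  rewrite Pi0 mulr0 big1 // => j _; rewrite -/(P i j).
  have [-> |/xy] := eqVneq (P i j) 0; first by rewrite !mulr0 subr0.
  rewrite yi mulr0 => /esym/eqP; rewrite mulf_eq0 (gt_eqF b0) => /eqP ->.
  by rewrite subrr.
have yi0 : 0 < y i by rewrite lt0r yi.
rewrite mulr_sumr; apply: eq_bigr => j _; rewrite -mulrBl -/(P i j).
have [-> |/xy Eij] := eqVneq (P i j) 0; first by rewrite !mulr0.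
have xj0 : 0 < x j by rewrite -(pmulr_rgt0 _ b0) -Eij mulr_gt0.
congr (_ * _); rewrite !logsE //.
have := congr1 ln Eij; rewrite -!RmultE !ln_mult; try exact/RltP.
by rewrite !RplusE; lra.
Qed.

End TraceLog.

(** * Translation of the concrete matrices *)

Section Bridge.
Local Open Scope ring_scope.
Local Open Scope sesquilinear_scope.
Local Notation "x %:C" := (real_complex R x) : ring_scope.

Definition toC (z : Defs.C) : R[i] := Complex (re z) (im z).
Definition ofC (z : R[i]) : Defs.C := mkC (complex.Re z) (complex.Im z).

Lemma toC_inj : injective toC.
Proof. by move=> [a b] [c d] [-> ->]. Qed.

Lemma ofCK : cancel ofC toC.
Proof. by case. Qed.

Lemma toC_add z w : toC (Cadd z w) = toC z + toC w.
Proof. by []. Qed.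

Lemma toC_mul z w : toC (Cmul z w) = toC z * toC w.
Proof. by []. Qed.

Lemma toC_conj z : toC (Cconj z) = (toC z)^*.
Proof. by []. Qed.

Lemma toC_sum n f : toC (csum n f) = \sum_(i < n) toC (f i).
Proof.
rewrite /csum; have E s : toC (List.fold_right Cadd C0 (List.map f (List.seq s n))) =
    \sum_(i < n) toC (f (s + i)%N).
  elim: n s => [|n IHn] s; first by rewrite big_ord0.
  rewrite big_ord_recl /= toC_add IHn addn0; congr (_ + _).
  by apply: eq_bigr => i _; rewrite /= addSnnS.
exact: E.
Qed.

Definition mx n (A : Mat) : 'M[R[i]]_n := \matrix_(i, j) toC (A i j).

Definition unmx n (M : 'M[R[i]]_n) : Mat := fun i j =>
  match @insub nat (fun k => (k < n)%N) 'I_n i, @insub nat (fun k => (k < n)%N) 'I_n j with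
  | Some i', Some j' => ofC (M i' j')
  | _, _ => C0
  end.

Lemma unmxK n (M : 'M[R[i]]_n) : mx n (unmx M) = M.
Proof. by apply/matrixP => i j; rewrite mxE /unmx !valK ofCK. Qed.

Lemma meqP n A B : meq n A B <-> mx n A = mx n B.
Proof.
split=> [AB|/matrixP AB i j /ssrnat.ltP lti /ssrnat.ltP ltj].
  by apply/matrixP => i j; rewrite !mxE AB //; apply/ssrnat.ltP.
by apply: toC_inj; have := AB (Ordinal lti) (Ordinal ltj); rewrite !mxE.
Qed.

Section Dim.
Variable n : nat.
Local Notation mx := (mx n).

Lemma mx_mul A B : mx (mmul n A B) = mx A *m mx B.
Proof.
apply/matrixP => i j; rewrite !mxE toC_sum; apply: eq_bigr => k _.
by rewrite !mxE toC_mul.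
Qed.

Lemma mx_add A B : mx (madd A B) = mx A + mx B.
Proof. by apply/matrixP => i j; rewrite !mxE. Qed.

Lemma mx_scale r A : mx (mscale r A) = r%:C *: mx A.
Proof. by apply/matrixP => i j; rewrite !mxE toC_mul. Qed.

Lemma mx_adj A : mx (Defs.adj A) = (mx A)^t*.
Proof. by apply/matrixP => i j; rewrite !mxE toC_conj. Qed.

Lemma mx_idm : mx idm = 1%:M.
Proof.
apply/matrixP => i j; rewrite !mxE /idm; case: Nat.eqb_spec => [/val_inj->|ij].
  by rewrite eqxx.
by case: eqVneq => // /(congr1 val).
Qed.

Lemma mx_diagm d : mx (diagm d) = rdiag (fun i : 'I_n => d i).
Proof.
apply/matrixP => i j; rewrite !mxE /diagm; case: Nat.eqb_spec => [/val_inj->|ij].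
  by rewrite eqxx.
by case: eqVneq => // /(congr1 val).
Qed.

Lemma re_trace A : re (trace n A) = retr (mx A).
Proof.
rewrite -[LHS]/(complex.Re (toC _)) toC_sum; congr complex.Re.
by apply: eq_bigr => i _; rewrite mxE.
Qed.

Lemma unitary_mx U : unitary n U <-> (mx U)^t* *m mx U = 1%:M.
Proof. by rewrite /unitary meqP mx_mul mx_adj mx_idm. Qed.

Lemma spec_decomp_mx A p : spec_decomp n A p <->
  (mx p.2)^t* *m mx p.2 = 1%:M /\ mx A = spec (mx p.2) (fun i => p.1 i).
Proof. by rewrite /spec_decomp unitary_mx meqP !mx_mul mx_adj mx_diagm. Qed.

Lemma hermitian_mx A : Defs.hermitian n A <-> (mx A)^t* = mx A.
Proof. by rewrite /Defs.hermitian meqP mx_adj. Qed.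

Lemma hermitian_spec_decomp A : Defs.hermitian n A -> exists p, spec_decomp n A p.
Proof.
move=> /hermitian_mx hA.
have hsA : mx A \is hermsymmx.
  by apply/is_hermitianmxP; rewrite expr0 scale1r hA.
have /orthomx_spectralP E := hermitian_normalmx hsA.
have U := spectral_unitarymx (mx A).
pose d : nat -> R := fun k =>
  if insub k is Some i then complex.Re (spectral_diag (mx A) 0 i) else 0.
(* The spectral theorem gives [A = U^-1 D U] with [U] unitary, so the eigenvectors are the columns
   of the adjoint of [U]. *)
exists (d, unmx ((spectralmx (mx A))^t*)); apply/spec_decomp_mx; rewrite /= unmxK.
split; first by rewrite trmxCK; apply/unitarymxP.
rewrite {1}E invmx_unitary // /spec trmxCK; congr (_ *m diag_mx _ *m _).
apply/rowP => i; rewrite mxE /d valK RRe_real //.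
by move/mxOverP: (hermitian_spectral_diag_real hsA); apply.
Qed.

(** The decomposition picked by [epsilon] depends on the matrix but not on [f], so one pair [V], [d]
    serves all functions. *)
Lemma funcalc_mx A : Defs.hermitian n A -> exists V d,
  [/\ V^t* *m V = 1%:M, mx A = spec V d &
      forall f, mx (funcalc n f A) = spec V (fun i => f (d i))].
Proof.
move=> /hermitian_spec_decomp exp.
have := epsilon_spec (inhabits ((fun _ => R0), (fun _ _ => C0))) _ exp.
move=> /spec_decomp_mx [U E].
eexists; eexists; split; [exact: U|exact: E|move=> f].
by rewrite /funcalc !mx_mul mx_adj mx_diagm.
Qed.

Lemma csum_quadratic A x : csum n (fun i => Cmul (Cconj (x i)) (mvec n A x i)) =
  ofC (\sum_(i < n) (toC (x i))^* * \sum_(j < n) mx A i j * toC (x j)).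
Proof.
apply: toC_inj; rewrite ofCK toC_sum; apply: eq_bigr => i _.
rewrite toC_mul toC_conj /mvec toC_sum; congr (_ * _).
by apply: eq_bigr => j _; rewrite mxE toC_mul.
Qed.

Lemma psd_gram A : psd n A -> gram (mx A).
Proof.
move=> [hA posA]; have [p /spec_decomp_mx[U E]] := hermitian_spec_decomp hA.
rewrite E; apply: gram_spec => i; set V := mx p.2 in U E *.
rewrite -(rdiag_diag (fun i => p.1 i) i) -(spec_diag _ U) -E.
(* The quadratic form at the [i]-th eigenvector is the [i]-th eigenvalue. *)
have /RleP := posA (fun k => p.2 k i); rewrite csum_quadratic /=.
rewrite -mulmxA mxE; congr (_ <= complex.Re _); apply: eq_bigr => k _.
rewrite adjE; congr (_ * _); first by rewrite mxE.
by rewrite mxE; apply: eq_bigr => j _; rewrite [V _ _]mxE.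
Qed.

(** For a kernel vector [v] of the mixture, [a |P v|^2 + (1 - a) |Q v|^2 = 0], so [P v = 0]. This
    rules out the infinite value in [tele]. *)
Lemma supp_sub_convex (a : R) A B : 0 < a < 1 -> psd n A -> psd n B ->
  supp_sub n A (madd (mscale a A) (mscale (1 - a)%R B)).
Proof.
move=> /andP[a0 a1] /psd_gram[P EA] /psd_gram[Q EB] x Xx.
pose v : 'cV[R[i]]_n := \col_i toC (x i).
have mvecE (M : Mat) (i : 'I_n) : toC (mvec n M x i) = (mx M *m v) i 0.
  by rewrite toC_sum mxE; apply: eq_bigr => j _; rewrite !mxE toC_mul.
have Xv : mx (madd (mscale a A) (mscale (1 - a)%R B)) *m v = 0.
  apply/matrixP => i j; rewrite ord1 -mvecE Xx; last exact/ssrnat.ltP.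
  by rewrite mxE.
have quad (M : 'M[R[i]]_n) : v^t* *m (M^t* *m M) *m v = (M *m v)^t* *m (M *m v).
  by rewrite adjM !mulmxA.
have Pv : P *m v = 0.
  apply: normal_diag_eq0 => i.
  have : complex.Re ((v^t* *m (mx (madd (mscale a A) (mscale (1 - a)%R B)) *m v)) i i) = 0.
    by rewrite Xv mulmx0 mxE.
  rewrite mx_add !mx_scale EA EB mulmxA mulmxDr mulmxDl -!scalemxAr -!scalemxAl !quad.
  rewrite entryD !entryZ ReD !ReZ.
  move/eqP; rewrite paddr_eq0; first by rewrite mulf_eq0 gt_eqF // => /andP[/eqP].
    by rewrite mulr_ge0 ?normal_diag_ge0 ?ltW.
  by rewrite mulr_ge0 ?normal_diag_ge0 // subr_ge0 ltW.
move=> i /ssrnat.ltP lti; apply: toC_inj.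
by rewrite (mvecE A (Ordinal lti)) EA -mulmxA Pv mulmx0 mxE.
Qed.

Lemma hermitian_madd A B : Defs.hermitian n A -> Defs.hermitian n B ->
  Defs.hermitian n (madd A B).
Proof.
rewrite !hermitian_mx mx_add => hA hB.
by rewrite linearD map_mxD /= hA hB.
Qed.

Lemma hermitian_mscale (r : R) A : Defs.hermitian n A -> Defs.hermitian n (mscale r A).
Proof. by rewrite !hermitian_mx mx_scale adjZ => ->. Qed.

End Dim.
End Bridge.

(** * The telescopic relative entropy *)

Section Telescopic.
Local Open Scope ring_scope.
Local Open Scope sesquilinear_scope.
Local Notation "x %:C" := (real_complex R x) : ring_scope.
Variable n : nat.
Local Notation mx := (mx n).
Implicit Types (rho s A B : Mat).

Definition mix (a : R) A B : Mat := madd (mscale a A) (mscale (Rminus (IZR 1) a) B).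

(** The part of the relative entropy that depends on [s]; the term [Tr rho log rho] cancels in
    differences. *)
Definition cross_log (a : R) rho s : R :=
  re (trace n (mmul n rho (funcalc n logs (mix a rho s)))).

Lemma mx_mix a A B : mx (mix a A B) = a%:C *: mx A + (1 - a)%:C *: mx B.
Proof. by rewrite mx_add !mx_scale. Qed.

Lemma mix_spec (a : R) rho s : psd n rho -> psd n s -> exists V y,
  [/\ V^t* *m V = 1%:M, mx (mix a rho s) = spec V y &
      cross_log a rho s = retr (mx rho *m spec V (fun i => logs (y i)))].
Proof.
move=> [hr _] [hs _].
have hm : Defs.hermitian n (mix a rho s) by apply: hermitian_madd; exact: hermitian_mscale.
have [V [y [V1 E F]]] := funcalc_mx hm.
by exists V, y; split=> //; rewrite /cross_log re_trace mx_mul F.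
Qed.

Lemma tele_sub (a : R) rho s1 s2 : 0 < a < 1 -> psd n rho -> psd n s1 -> psd n s2 ->
  tele n a rho s1 - tele n a rho s2 =
  (cross_log a rho s2 - cross_log a rho s1) / (- ln a).
Proof.
move=> a01 pr p1 p2; rewrite /tele /relent.
case: excluded_middle_informative => [_|]; last by case; exact: supp_sub_convex.
case: excluded_middle_informative => [_|]; last by case; exact: supp_sub_convex.
rewrite !RealsE -mulrBl; congr (_ / _).
rewrite -/(mix a rho s1) -/(mix a rho s2).
by rewrite -/(cross_log a rho s1) -/(cross_log a rho s2); ring.
Qed.

Lemma state_psd A : state n A -> psd n A.
Proof. by case. Qed.

Lemma state_retr A : state n A -> retr (mx A) = 1.
Proof. by move=> [_ tA]; rewrite -re_trace tA. Qed.

Lemma gram_mix_sub (a : R) A B : a < 1 -> psd n B ->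
  gram (mx (mix a A B) - a%:C *: mx A).
Proof.
move=> a1 /psd_gram gB; rewrite mx_mix [_ *: _ + _]addrC addrK.
by apply: gramZ => //; rewrite subr_ge0 ltW.
Qed.

Lemma cross_log_sub_le (a : R) rho s1 s2 (D : 'M[R[i]]_n) :
  0 < a < 1 -> state n rho -> psd n s1 -> psd n s2 ->
  gram D -> gram (mx s1 + D - mx s2) ->
  cross_log a rho s2 - cross_log a rho s1 <= ln (1 + (1 - a) * retr D / a)%R.
Proof.
move=> /andP[a0 a1] sr p1 p2 gD g12; have pr := state_psd sr.
have [W [x [W1 X ->]]] := mix_spec a pr p1.
have [V [y [V1 Y ->]]] := mix_spec a pr p2.
have a1' : 0 <= 1 - a by rewrite subr_ge0 ltW.
rewrite -retrZ; apply: trace_log_diff_le => //.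
- exact: psd_gram.
- exact: state_retr.
- exact: gramZ.
- by rewrite -X; exact: gram_mix_sub.
- by rewrite -Y; exact: gram_mix_sub.
(* The terms [a rho] cancel, leaving [1 - a] times [s1 + D - s2]. *)
rewrite -X -Y !mx_mix -[_ + _ + _ *: D]addrA opprD addrACA subrr add0r.
rewrite -scalerDr -scalerBr; exact: gramZ.
Qed.

(** The parts come from the positive and negative eigenvalues of the difference. The first has trace
    [tdist] by definition, and the second has the same trace because the difference of two states is
    traceless. *)
Lemma tdist_jordan s1 s2 : state n s1 -> state n s2 ->
  exists Dp Dm : 'M[R[i]]_n, [/\ gram Dp, gram Dm, mx s1 - mx s2 = Dp - Dm,
    retr Dp = tdist n s1 s2 & retr Dm = tdist n s1 s2].
Proof.
move=> st1 st2; have [[h1 _] _] := st1; have [[h2 _] _] := st2.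
have hm : Defs.hermitian n (madd s1 (mscale (-1) s2)).
  by apply: hermitian_madd => //; exact: hermitian_mscale.
have [V [d [V1 E F]]] := funcalc_mx hm.
have sE : mx s1 - mx s2 = spec V d.
  by rewrite -E mx_add mx_scale rmorphN rmorph1 scaleN1r.
pose dp i := Num.max (d i) 0; pose dm i := Num.max (- d i) 0.
have dE i : d i = dp i - dm i.
  by rewrite /dp /dm; case: (lerP (d i) 0) => d0; case: (lerP (- d i) 0) => d1; lra.
have pmE : mx s1 - mx s2 = spec V dp - spec V dm.
  rewrite sE /spec -mulmxBl -mulmxBr; congr (_ *m _ *m _).
  by apply/matrixP => i j; rewrite !mxE dE rmorphB mulrnBl.
have tp : retr (spec V dp) = tdist n s1 s2.
  rewrite /tdist re_trace F; congr retr.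
  rewrite /spec; congr (_ *m diag_mx _ *m _).
  by apply/rowP => i; rewrite !mxE RmaxE.
exists (spec V dp), (spec V dm); split; [| |exact: pmE|exact: tp|].
- by apply: gram_spec => i; rewrite le_max lexx orbT.
- by apply: gram_spec => i; rewrite le_max lexx orbT.
rewrite -tp; apply/eqP; rewrite eq_sym -subr_eq0 -retrB -pmE retrB.
by rewrite !state_retr // subrr.
Qed.

(** The one-sided bound is used twice: with [Dm], as [s1 + Dm - s2 = Dp], and with the states
    exchanged and [Dp], as [s2 + Dp - s1 = Dm]. Both parts have trace [t]. *)
Lemma cross_log_dist (a t : R) rho s1 s2 :
  0 < a < 1 -> state n rho -> state n s1 -> state n s2 -> tdist n s1 s2 = t ->
  0 <= t /\ `|cross_log a rho s2 - cross_log a rho s1| <= ln (1 + (1 - a) * t / a)%R.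
Proof.
move=> a01 sr st1 st2 <-.
have [Dp [Dm [gp gm E tp tm]]] := tdist_jordan st1 st2.
have p1 := state_psd st1; have p2 := state_psd st2.
split.
  by rewrite -tp retrE sumr_ge0 // => i _; exact: gram_diag_ge0.
rewrite ler_norml; apply/andP; split.
  rewrite -lerN2 opprK opprB -tp; apply: cross_log_sub_le => //.
  by rewrite addrAC -opprB E opprB subrK.
rewrite -tm; apply: cross_log_sub_le => //.
by rewrite addrAC E subrK.
Qed.

(** Orthogonality gives [rho s1 = s1 rho = 0]. With [b = a + (1 - a) t], both [a Y rho] and
    [b rho X] then equal [a b rho^2]. *)
Lemma cross_log_orth (a t : R) rho s1 s2 :
  0 < a < 1 -> 0 <= t -> state n rho -> state n s1 -> state n s2 ->
  trace n (mmul n rho s1) = C0 ->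
  meq n s2 (madd (mscale t rho) (mscale (1 - t)%R s1)) ->
  cross_log a rho s2 - cross_log a rho s1 = ln (a + (1 - a) * t)%R - ln a.
Proof.
move=> /andP[a0 a1] t0 sr st1 st2 orth /(meqP n) s2E.
have pr := state_psd sr; have p1 := state_psd st1; have p2 := state_psd st2.
have [W [x [W1 X ->]]] := mix_spec a pr p1.
have [V [y [V1 Y ->]]] := mix_spec a pr p2.
have grho := psd_gram pr; have gs1 := psd_gram p1.
have rs : mx rho *m mx s1 = 0.
  by apply: gram_orth => //; rewrite -mx_mul -re_trace orth.
have sr0 : mx s1 *m mx rho = 0.
  rewrite -(gram_adj grho) -(gram_adj gs1) -adjM rs.
  by apply/matrixP => i j; rewrite !mxE conjC0.
apply: (trace_log_diff_eq a0 _ V1 W1 grho (state_retr sr)).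
- by rewrite ltr_pwDl // mulr_ge0 // subr_ge0 ltW.
- by rewrite -X; exact: gram_mix_sub.
- by rewrite -Y; exact: gram_mix_sub.
rewrite -X -Y !mx_mix s2E mx_add !mx_scale.
rewrite scalerDr !scalerA mulmxDl mulmxDr mulmxDl.
rewrite -!scalemxAl -!scalemxAr rs sr0 !scaler0 !addr0.
by rewrite -scalerDl !scalerA -!rmorphM -!rmorphD -!rmorphM mulrC.
Qed.
End Telescopic.

(** * Scalar telescopic entropy and the linear bound *)

Section ScalarTelescopic.
Local Open Scope ring_scope.
Variables a t : R.
Hypotheses (a01 : 0 < a < 1) (t0 : 0 <= t).

Let a0 : 0 < a. Proof. by case/andP: a01. Qed.
Let w0 : 0 <= (1 - a) * t.
Proof. by rewrite mulr_ge0 // subr_ge0; case/andP: a01 => _ /ltW. Qed.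

Lemma oppr_ln_gt0 : 0 < - ln a.
Proof.
case/andP: a01 => _ /RltP a1; rewrite oppr_gt0; apply/RltP.
by have /RltP a0' := a0; have := ln_increasing a 1 a0' a1; rewrite ln_1.
Qed.

Lemma ln_1Dratio : ln (1 + (1 - a) * t / a)%R = ln (a + (1 - a) * t)%R - ln a.
Proof.
have -> : (a + (1 - a) * t)%R = Rmult a (1 + (1 - a) * t / a)%R.
  by rewrite RmultE mulrDr mulr1 [a * (_ / a)]mulrC divfK ?gt_eqF.
rewrite ln_mult; first by rewrite RplusE [ln a + _]addrC addrK.
  exact/RltP.
by apply/RltP; rewrite ltr_pwDl // divr_ge0 // ltW.
Qed.

Lemma tele_scE : Rminus (IZR 1) (tele_sc a (IZR 1) t) =
  (ln (a + (1 - a) * t)%R - ln a) / - ln a.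
Proof.
have l0 : - ln a != 0 by rewrite gt_eqF // oppr_ln_gt0.
rewrite /tele_sc !RealsE ln_1 mul1r mulr1 sub0r.
by rewrite -[X in X - _](divff l0) -mulrBl opprK addrC.
Qed.

(** This is [ln (1 + z) <= z] at [z = (1 - a) * t / a], divided by [- ln a]. *)
Lemma ln_ratio_le :
  (ln (a + (1 - a) * t)%R - ln a) / - ln a <= (1 - a) / (- a * ln a) * t.
Proof.
have l0 := oppr_ln_gt0.
have -> : (1 - a) / (- a * ln a) * t = (1 - a) * t / a / - ln a.
  by rewrite mulNr -mulrN invfM; ring.
rewrite ler_pM2r ?invr_gt0 // -ln_1Dratio.
have pos : 0 < 1 + (1 - a) * t / a by rewrite ltr_pwDl // divr_ge0 // ltW.
by apply: le_trans (ln_le_subr1 pos) _; rewrite [1 + _]addrC addrK.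
Qed.
End ScalarTelescopic.

(** * Continuity of the telescopic relative entropy *)

Open Scope R_scope.

Theorem theorem3 (n : nat) (a t : R) (rho s1 s2 : Mat) :
  0 < a < 1 ->
  state n rho -> state n s1 -> state n s2 ->
  tdist n s1 s2 = t ->
  Rabs (tele n a rho s1 - tele n a rho s2) <= 1 - tele_sc a 1 t /\
  1 - tele_sc a 1 t = (ln (a + (1 - a) * t) - ln a) / (- ln a) /\
  (ln (a + (1 - a) * t) - ln a) / (- ln a) <= (1 - a) / (- a * ln a) * t /\
  (trace n (mmul n rho s1) = C0 ->
   meq n s2 (madd (mscale t rho) (mscale (1 - t) s1)) ->
   Rabs (tele n a rho s1 - tele n a rho s2) = 1 - tele_sc a 1 t).
Proof.
move=> [/RltP a0 /RltP a1] sr st1 st2 tE.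
have a01 : (0 < a < 1)%R by rewrite a0.
have [t0 dist] := cross_log_dist a01 sr st1 st2 tE.
have l0 := oppr_ln_gt0 a01.
have normE : (`|tele n a rho s1 - tele n a rho s2| =
    `|cross_log n a rho s2 - cross_log n a rho s1| / - ln a)%R.
  rewrite (tele_sub a01 (state_psd sr) (state_psd st1) (state_psd st2)).
  by rewrite normrM normfV (gtr0_norm l0).
have eqn := tele_scE t a01.
split; last split; last split.
- apply/RleP; rewrite eqn RabsE RminusE normE ler_pM2r ?invr_gt0 //.
  by rewrite -ln_1Dratio.
- by rewrite eqn !RealsE.
- by apply/RleP; rewrite !RealsE; exact: ln_ratio_le.
move=> orth s2E; rewrite eqn RabsE RminusE normE.
rewrite (cross_log_orth a01 t0 sr st1 st2 orth s2E) -ln_1Dratio // ger0_norm //.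
(* The logarithm is nonnegative because [dist] bounds an absolute value by it. *)
exact: le_trans dist.
Qed.
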